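(* Let $(\mathcal{S}_d,\rho)$ be a metric space on rankings, fix a fairness notion (one of $(\bar{\alpha},\bar{\beta})$-$k$-fair, block-$k$-fair, or strict-$k$-fair for given groups and parameters), and let $q\ge1$. Suppose there is a $t(d)$-time $c$-approximation algorithm $\mathcal{A}$ (for some $c\ge1$) for the closest fair ranking problem over $(\mathcal{S}_d,\rho)$. Then there is a $(c+2)$-approximation algorithm for the $q$-mean fair rank aggregation problem running in time $O(n\cdot t(d)+n^2\cdot f(d))$, where $n$ is the number of input rankings and $f(d)$ is the time to compute $\rho(\pi_1,\pi_2)$ for any $\pi_1,\pi_2\in\mathcal{S}_d$.
   Context: $\mathcal{S}_d$ is the set of rankings of $[d]$, whose elements are partitioned into groups $G_1,\dots,G_g$ with parameters $\bar{\alpha},\bar{\beta}\in[0,1]^g$, $k\in[d]$ (and block length $b$ for block fairness). Fairness notions: $\pi$ is $(\bar{\alpha},\bar{\beta})$-$k$-fair if its length-$k$ prefix $P$ has $\lfloor\alpha_ik\rfloor\le|P\cap G_i|\le\lceil\beta_ik\rceil$ for all $i$; block-$k$-fair if every prefix $P$ with $|P|\ge k$, $|P|\equiv0\pmod b$ has $\alpha_i|P|\le|P\cap G_i|\le\beta_i|P|$; strict-$k$-fair if every prefix $P$ with $|P|\ge k$ has $\lfloor\alpha_i|P|\rfloor\le|P\cap G_i|\le\lceil\beta_i|P|\rceil$. Closest fair ranking problem: given $\pi$, find a fair $\pi^*$ minimizing $\rho(\pi,\pi^* )$; a $c$-approximation outputs a fair $\sigma$ with $\rho(\pi,\sigma)\le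 c\cdot\min_{\text{fair }\pi^*}\rho(\pi,\pi^* )$. $q$-mean fair rank aggregation: given a set $S\subseteq\mathcal{S}_d$ of $n$ rankings, find a fair $\sigma$ minimizing $\mathrm{Obj}_q(S,\sigma)=(\sum_{\pi\in S}\rho(\pi,\sigma)^q)^{1/q}$ (for $q=\infty$, $\max_{\pi\in S}\rho(\pi,\sigma)$); a $c'$-approximation outputs a fair $\sigma$ with objective at most $c'$ times the optimum. *)

(* Defs.v *)
(* MathComp world, over an abstract [R : realType]. *)
From mathcomp Require Import all_boot all_order all_algebra all_fingroup.
From mathcomp Require Import reals constructive_ereal exp.

Set Implicit Arguments.
Unset Strict Implicit.
Unset Printing Implicit Defensive.

Import Order.TTheory GRing.Theory Num.Theory.
Local Open Scope ring_scope.

(** * Rankings and fairness *)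

(* A ranking of [d] elements is [p : 'S_d], where [p i] is the element placed
   at position [i]; [prefix p m] is only used for [m <= d]. *)
Definition prefix (d : nat) (p : 'S_d) (m : nat) : {set 'I_d} :=
  [set p i | i : 'I_d & (i < m)%N].

(* [grp x] is the index of the group containing [x]; groups may be empty.
   [block_len] is only used by block fairness. *)
Record fair_params (R : realType) (d : nat) := FairParams {
  ngroups : nat;
  grp : 'I_d -> 'I_ngroups;
  alpha : 'I_ngroups -> R;
  beta : 'I_ngroups -> R;
  kpar : nat;
  block_len : nat;
  alpha01 : forall i, 0 <= alpha i <= 1;
  beta01 : forall i, 0 <= beta i <= 1;
  kpar_range : (0 < kpar <= d)%N;
  block_len_gt0 : (0 < block_len)%N }.

Definition group_of (R : realType) d (P : fair_params R d)
    (i : 'I_(ngroups P)) : {set 'I_d} := [set x | grp P x == i].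

Definition floor_ceil_fair (R : realType) d (P : fair_params R d)
    (p : 'S_d) (m : nat) : Prop :=
  forall i : 'I_(ngroups P),
    Num.floor (alpha i * m%:R) <= (#|prefix p m :&: group_of i|%:Z)
                               <= Num.ceil (beta i * m%:R).

Definition k_fair (R : realType) d (P : fair_params R d) (p : 'S_d) : Prop :=
  floor_ceil_fair P p (kpar P).

Definition block_k_fair (R : realType) d (P : fair_params R d)
    (p : 'S_d) : Prop :=
  forall m : nat, (kpar P <= m <= d)%N -> (m = 0 %[mod block_len P])%N ->
  forall i : 'I_(ngroups P),
    alpha i * m%:R <= (#|prefix p m :&: group_of i|%:R) <= beta i * m%:R.

Definition strict_k_fair (R : realType) d (P : fair_params R d)
    (p : 'S_d) : Prop :=
  forall m : nat, (kpar P <= m <= d)%N -> floor_ceil_fair P p m.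

Variant fairness_notion := KFair | BlockKFair | StrictKFair.

Definition fair (N : fairness_notion) (R : realType) d (P : fair_params R d) :
    'S_d -> Prop :=
  match N with
  | KFair => k_fair P
  | BlockKFair => block_k_fair P
  | StrictKFair => strict_k_fair P
  end.

(** * Metrics, objectives and approximation *)

Definition is_metric (R : realType) (T : Type) (rho : T -> T -> R) : Prop :=
  [/\ forall x y, 0 <= rho x y,
      forall x y, rho x y = 0 <-> x = y,
      forall x y, rho x y = rho y x
    & forall x y z, rho x z <= rho x y + rho y z].

(* The case [-oo] is irrelevant: only [1 <= q] is used. *)
Definition Obj (R : realType) (q : \bar R) d (rho : 'S_d -> 'S_d -> R)
    (S : {set 'S_d}) (sigma : 'S_d) : R :=
  match q with
  | r%:E => powR (\sum_(p in S) powR (rho p sigma) r) r^-1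
  | +oo%E => \big[Num.max/0]_(p in S) rho p sigma
  | -oo%E => 0
  end.

Definition is_minimizer (R : realType) (T : Type) (feas : T -> Prop)
    (F : T -> R) (x : T) : Prop :=
  feas x /\ forall y, feas y -> F x <= F y.

Definition is_approx (R : realType) (T : Type) (feas : T -> Prop)
    (F : T -> R) (c : R) (x : T) : Prop :=
  feas x /\ exists2 opt, is_minimizer feas F opt & F x <= c * F opt.

(** * Real RAM

   A unit-cost random access machine with integer cells (addition, truncated
   subtraction, comparison, indirect addressing) and exact real cells (field
   operations, comparison, and [x |-> x ^ q] for the exponent [q] of the
   objective).  The only real constants are images of naturals, and there is
   no conversion from reals to integers.

   Memory is organised in arrays addressed by (array number, index).  A
   procedure reads the arrays passed to it, which it cannot modify, and reads
   and writes its own local arrays, which are initially zero; its result is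
   its local array number 0.  Hence a call passes array references and
   receives one array reference, which is why it is charged a constant plus
   the running time of the body. *)

(* An array has an integer part and a real part, indexed independently. *)
Record arr (R : realType) := Arr { ints : nat -> nat; reals : nat -> R }.

Definition arr0 (R : realType) : arr R := Arr (fun=> 0%N) (fun=> 0 : R).

Record frame (R : realType) := Frame {
  inputs : nat -> arr R;
  locals : nat -> arr R }.

Variant space := Inp | Loc.

Inductive nexp :=
| NCst of nat
| NGet of space & nexp & nexp (* array number, index *)
| NAdd of nexp & nexp
| NSub of nexp & nexp.

Inductive rexp :=
| ROfNat of nexp
| RGet of space & nexp & nexp
| RAdd of rexp & rexp
| RSub of rexp & rexp
| RMul of rexp & rexp
| RDiv of rexp & rexp
| RPowq of rexp.

Inductive bexp :=
| BNle of nexp & nexp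
| BRle of rexp & rexp
| BNot of bexp.

Inductive cmd :=
| Skip
| SetN of nexp & nexp & nexp (* local array number, index, value *)
| SetR of nexp & nexp & rexp
| Seq of cmd & cmd
| If of bexp & cmd & cmd
| While of bexp & cmd
| Call of nexp & cmd & seq (space * nexp). (* destination, body, arguments *)

Definition upd (T : Type) (f : nat -> T) (i : nat) (v : T) : nat -> T :=
  fun j => if j == i then v else f j.

Definition get_arr (R : realType) (fr : frame R) (s : space) : nat -> arr R :=
  match s with Inp => inputs fr | Loc => locals fr end.

Fixpoint neval (R : realType) (fr : frame R) (e : nexp) : nat :=
  match e with
  | NCst n => n
  | NGet s a i => ints (get_arr fr s (neval fr a)) (neval fr i)
  | NAdd e1 e2 => neval fr e1 + neval fr e2
  | NSub e1 e2 => neval fr e1 - neval fr e2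
  end%N.

(* For [q = +oo] the operation brings no power beyond field arithmetic. *)
Definition powq (R : realType) (q : \bar R) (x : R) : R :=
  if q is r%:E then powR x r else x.

Fixpoint reval (R : realType) (q : \bar R) (fr : frame R) (e : rexp) : R :=
  match e with
  | ROfNat e1 => (neval fr e1)%:R
  | RGet s a i => reals (get_arr fr s (neval fr a)) (neval fr i)
  | RAdd e1 e2 => reval q fr e1 + reval q fr e2
  | RSub e1 e2 => reval q fr e1 - reval q fr e2
  | RMul e1 e2 => reval q fr e1 * reval q fr e2
  | RDiv e1 e2 => reval q fr e1 / reval q fr e2
  | RPowq e1 => powq q (reval q fr e1)
  end.

Fixpoint beval (R : realType) (q : \bar R) (fr : frame R) (b : bexp) : bool :=
  match b with
  | BNle e1 e2 => (neval fr e1 <= neval fr e2)%N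
  | BRle e1 e2 => reval q fr e1 <= reval q fr e2
  | BNot b1 => ~~ beval q fr b1
  end.

Fixpoint ncost (e : nexp) : nat :=
  match e with
  | NCst _ => 1
  | NGet _ e1 e2 | NAdd e1 e2 | NSub e1 e2 => (ncost e1 + ncost e2).+1
  end%N.

Fixpoint rcost (e : rexp) : nat :=
  match e with
  | ROfNat e1 => (ncost e1).+1
  | RGet _ e1 e2 => (ncost e1 + ncost e2).+1
  | RAdd e1 e2 | RSub e1 e2 | RMul e1 e2 | RDiv e1 e2 =>
      (rcost e1 + rcost e2).+1
  | RPowq e1 => (rcost e1).+1
  end%N.

Fixpoint bcost (b : bexp) : nat :=
  match b with
  | BNle e1 e2 => (ncost e1 + ncost e2).+1
  | BRle e1 e2 => (rcost e1 + rcost e2).+1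
  | BNot b1 => (bcost b1).+1
  end%N.

Definition args_cost (args : seq (space * nexp)) : nat :=
  (\sum_(x <- args) (ncost x.2).+1)%N.

Definition set_int (R : realType) (fr : frame R) (a i v : nat) : frame R :=
  let x := locals fr a in
  Frame (inputs fr) (upd (locals fr) a (Arr (upd (ints x) i v) (reals x))).

Definition set_real (R : realType) (fr : frame R) (a i : nat) (v : R) :
    frame R :=
  let x := locals fr a in
  Frame (inputs fr) (upd (locals fr) a (Arr (ints x) (upd (reals x) i v))).

Definition set_arr (R : realType) (fr : frame R) (a : nat) (x : arr R) :
    frame R :=
  Frame (inputs fr) (upd (locals fr) a x).

Definition init_frame (R : realType) (xs : seq (arr R)) : frame R :=
  Frame (fun i => nth (arr0 R) xs i) (fun=> arr0 R).

Definition eval_args (R : realType) (fr : frame R)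
    (args : seq (space * nexp)) : seq (arr R) :=
  [seq get_arr fr x.1 (neval fr x.2) | x <- args].

(* [exec q c fr t fr']: started in [fr], [c] halts in [fr'] after time [t]. *)
Inductive exec (R : realType) (q : \bar R) :
    cmd -> frame R -> nat -> frame R -> Prop :=
| exec_skip fr : exec q Skip fr 1%N fr
| exec_setn a i e fr :
    exec q (SetN a i e) fr (ncost a + ncost i + ncost e).+1
      (set_int fr (neval fr a) (neval fr i) (neval fr e))
| exec_setr a i e fr :
    exec q (SetR a i e) fr (ncost a + ncost i + rcost e).+1
      (set_real fr (neval fr a) (neval fr i) (reval q fr e))
| exec_seq c1 c2 fr t1 fr1 t2 fr2 :
    exec q c1 fr t1 fr1 -> exec q c2 fr1 t2 fr2 ->
    exec q (Seq c1 c2) fr (t1 + t2).+1 fr2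
| exec_if b c1 c2 fr t fr' :
    exec q (if beval q fr b then c1 else c2) fr t fr' ->
    exec q (If b c1 c2) fr (bcost b + t).+1 fr'
| exec_while_stop b c fr :
    ~~ beval q fr b -> exec q (While b c) fr (bcost b).+1 fr
| exec_while_step b c fr t1 fr1 t2 fr2 :
    beval q fr b -> exec q c fr t1 fr1 -> exec q (While b c) fr1 t2 fr2 ->
    exec q (While b c) fr (bcost b + t1 + t2).+1 fr2
| exec_call a c args fr t fr' :
    exec q c (init_frame (eval_args fr args)) t fr' ->
    exec q (Call a c args) fr (ncost a + args_cost args + t).+1
      (set_arr fr (neval fr a) (locals fr' 0%N)).

Definition runs (R : realType) (q : \bar R) (c : cmd) (xs : seq (arr R))
    (t : nat) (out : arr R) : Prop :=
  exists2 fr, exec q c (init_frame xs) t fr & out = locals fr 0%N.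

(** * Encodings

   Cells that are not mentioned are unconstrained. *)

Definition repr_ranking (R : realType) d (p : 'S_d) (x : arr R) : Prop :=
  ints x 0%N = d /\ forall i : 'I_d, ints x i.+1 = p i.

Definition repr_params (R : realType) d (P : fair_params R d) (x : arr R) :
    Prop :=
  [/\ [/\ ints x 0%N = d, ints x 1%N = ngroups P, ints x 2%N = kpar P
        & ints x 3%N = block_len P],
      forall y : 'I_d, ints x (4 + y)%N = grp P y,
      forall i : 'I_(ngroups P), reals x i = alpha i
    & forall i : 'I_(ngroups P), reals x (ngroups P + i)%N = beta i].

(** * Algorithms *)

(* [f d] is the time to compute [rho] on rankings of [d] elements. *)
Definition computes_metric (R : realType) (q : \bar R)
    (rho : forall d, 'S_d -> 'S_d -> R) (f : nat -> nat) (D : cmd) : Prop :=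
  forall d (p1 p2 : 'S_d) (x1 x2 : arr R), (0 < d)%N ->
    repr_ranking p1 x1 -> repr_ranking p2 x2 ->
    exists2 t, (t <= f d)%N &
    exists2 out, runs q D [:: x1; x2] t out & reals out 0%N = rho d p1 p2.

(* [K] is the class of parameter tuples that are allowed: a single tuple for
   each [d] when groups and parameters are fixed, all of them when they are
   part of the input.  Nothing is required of an algorithm when no ranking is
   fair. *)
Definition closest_fair_approx (R : realType) (q : \bar R)
    (N : fairness_notion) (K : forall d, fair_params R d -> Prop)
    (rho : forall d, 'S_d -> 'S_d -> R) (c : R) (t : nat -> nat) (A : cmd) :
    Prop :=
  forall d (P : fair_params R d) (p : 'S_d) (xP xp : arr R),
    K d P -> (exists sigma, fair N P sigma) ->
    repr_params P xP -> repr_ranking p xp ->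
    exists2 tau, (tau <= t d)%N &
    exists2 out, runs q A [:: xP; xp] tau out &
    exists2 sigma, repr_ranking sigma out &
      is_approx (fair N P) (rho d p) c sigma.

(* The input is the parameters, the number [n] of rankings, and an arbitrary
   enumeration without repetition of the [n] rankings of [S]. *)
Definition fair_aggregation_approx (R : realType) (q : \bar R)
    (N : fairness_notion) (K : forall d, fair_params R d -> Prop)
    (rho : forall d, 'S_d -> 'S_d -> R) (c : R) (T : nat -> nat -> nat)
    (B : cmd) : Prop :=
  forall d (P : fair_params R d) (S : {set 'S_d}) (s : seq 'S_d)
      (xP xn : arr R) (xs : seq (arr R)),
    K d P -> (exists sigma, fair N P sigma) ->
    S != set0 -> uniq s -> s =i S ->
    repr_params P xP -> ints xn 0%N = #|S| ->
    size xs = size s ->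
    (forall j, (j < size s)%N ->
       repr_ranking (nth 1%g s j) (nth (arr0 R) xs j)) ->
    exists2 tau, (tau <= T #|S| d)%N &
    exists2 out, runs q B [:: xP, xn & xs] tau out &
    exists2 sigma, repr_ranking sigma out &
      is_approx (fair N P) (Obj q (@rho d) S) c sigma.

(* Main.v *)
Require Import Defs.
From mathcomp Require Import all_boot all_order all_algebra all_fingroup.
From mathcomp Require Import reals constructive_ereal exp.
From mathcomp Require Import boolp zify.

(** Run the approximation algorithm on every input ranking and return the best
    of the resulting fair rankings.  If [opt] is an optimal fair aggregate and
    [p] is the input closest to [opt], then for every input [p'] the fair
    ranking [s] computed from [p] satisfies
      rho p' s <= rho p' p + rho p s <= rho p' opt + rho opt p + c * rho p opt
               <= (c + 2) * rho p' opt,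
    because [rho p opt <= rho p' opt].  This bound is pointwise in [p'], so it
    passes to every objective that is monotone and homogeneous; Minkowski's
    inequality is not needed. *)

Set Implicit Arguments.
Unset Strict Implicit.
Unset Printing Implicit Defensive.

Import Order.TTheory GRing.Theory Num.Theory.
Local Open Scope ring_scope.

(** * Approximation *)

(** One accumulation step of a score. The score omits the outer root [1/q] of the objective, which
    is not a machine operation; the root is monotone, so comparing scores suffices. *)
Definition combine (R : realType) (q : \bar R) (a x : R) : R :=
  if q is r%:E then a + powR x r else Num.max a x.

(** [\big] folds from the right and the program from the left; associativity and commutativity
    reconcile them for any start value, in particular for 0, which is not neutral for [Num.max] on
    [R]. *)
Lemma big_foldl (R : realType) (op : SemiGroup.com_law R) (x0 : R) (I : Type)
    (s : seq I) (F : I -> R) :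
  \big[op/x0]_(i <- s) F i = foldl (fun a i => op a (F i)) x0 s.
Proof.
have -> : foldl (fun a i => op a (F i)) x0 s = foldl op x0 (map F s).
  by elim: s x0 => //= i s IH x0; rewrite IH.
rewrite foldl_foldr; [|exact: SemiGroup.opA|exact: SemiGroup.opC].
by rewrite unlock /reducebig foldr_map.
Qed.

Lemma powR_mono (R : realType) (r x y : R) :
  0 <= r -> 0 <= x -> x <= y -> powR x r <= powR y r.
Proof.
move=> r0 x0 le_xy; have y0 := le_trans x0 le_xy.
have := @ge0_ler_powR R r r0 x y; exact.
Qed.

Lemma exists_minimizer (R : realType) (T : finType) (feas : T -> Prop)
    (F : T -> R) (x0 : T) :
  feas x0 -> exists x, is_minimizer feas F x.
Proof.
move=> /asboolP feas0.
case: (@Order.TotalTheory.arg_minP _ _ _ x0 (fun x => `[< feas x >]) F feas0).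
move=> x /asboolP feas_x x_min.
by exists x; split=> // y /asboolP; exact: x_min.
Qed.

Section Objective.
Variables (R : realType) (q : \bar R) (d : nat) (rho : 'S_d -> 'S_d -> R).
Variable S : {set 'S_d}.
Hypothesis q_ge1 : (1%:E <= q)%E.

Lemma le_Obj_combine (s : seq 'S_d) (x y : 'S_d) :
  uniq s -> s =i S ->
  foldl (combine q) 0 [seq rho p x | p <- s]
    <= foldl (combine q) 0 [seq rho p y | p <- s] ->
  Obj q rho S x <= Obj q rho S y.
Proof.
move=> us sS.
have foldl_map (G : R -> R -> R) (F : 'S_d -> R) :
    foldl G 0 (map F s) = foldl (fun a p => G a (F p)) 0 s.
  by elim: s {us sS} 0 => //= p s' IH a; rewrite IH.
have reindex (op : SemiGroup.com_law R) (F : 'S_d -> R) :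
    foldl (fun a p => op a (F p)) 0 s = \big[op/0]_(p in S) F p.
  rewrite -big_foldl (@big_uniq _ op 0 _ s F us); exact: eq_bigl.
rewrite !foldl_map; case: q q_ge1 => [r||]; [|move=> _|by []]; last first.
  by rewrite /combine /= !(reindex Num.max (rho^~ _)).
rewrite lee_fin /= => r1.
have r0 : 0 <= r^-1 by rewrite invr_ge0 (le_trans ler01).
rewrite !(reindex +%R (fun p => powR (rho p _) r)) => le_xy.
by apply: powR_mono => //; apply: sumr_ge0 => p _; exact: powR_ge0.
Qed.

Lemma Obj_le_scale (a : R) (x y : 'S_d) :
  0 <= a -> (forall p z, 0 <= rho p z) ->
  {in S, forall p, rho p x <= a * rho p y} ->
  Obj q rho S x <= a * Obj q rho S y.
Proof.
move=> a0 rho0 le_xy; case: q q_ge1 => [r||]; [|move=> _|by []]; last first.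
  (* The maximum starts from 0, so 0 itself must also lie below the right-hand side. *)
  apply: bigmax_le => [|p pS].
    by apply: mulr_ge0 => //; exact: bigmax_ge_id.
  apply: le_trans (le_xy _ pS) _; apply: ler_wpM2l => //.
  exact: (bigmax_sup p).
rewrite lee_fin => r1; have r0 : 0 < r by apply: lt_le_trans r1.
have pow_sum_ge0 z : 0 <= \sum_(p in S) powR (rho p z) r.
  by apply: sumr_ge0 => p _; exact: powR_ge0.
(* In this form the factor [a] can be moved under the root and then into the sum. *)
have -> : a = powR (powR a r) r^-1.
  by rewrite -powRrM mulfV ?gt_eqF// powRr1.
rewrite -powRM ?powR_ge0//; apply: powR_mono => //.
  by rewrite invr_ge0 ltW.
rewrite mulr_sumr; apply: ler_sum => p pS; rewrite -powRM//.
by apply: powR_mono; [exact: ltW|exact: rho0|exact: le_xy].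
Qed.

Lemma best_candidate_approx (feas : 'S_d -> Prop) (c : R) (s : seq 'S_d)
    (cand : nat -> 'S_d) (b : nat) :
  is_metric rho -> 0 <= c -> S != set0 -> s =i S ->
  (forall j, (j < size s)%N ->
     is_approx feas (rho (nth 1%g s j)) c (cand j)) ->
  (b < size s)%N ->
  (forall j, (j < size s)%N ->
     Obj q rho S (cand b) <= Obj q rho S (cand j)) ->
  is_approx feas (Obj q rho S) (c + 2) (cand b).
Proof.
move=> [rho0 _ rhoC rhoT] c0 /set0Pn[p0 p0S] sS appr bs best.
have [feas_b _] := appr _ bs; split=> //.
have [opt opt_min] := exists_minimizer (Obj q rho S) feas_b.
have [feas_opt _] := opt_min; exists opt => //.
(* [p] is the input closest to [opt]. The best candidate is no worse than the one computed from [p],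
   found at position [index p s], so only the latter has to be bounded. *)
have [p [pS p_min]] :=
  exists_minimizer (feas := fun p => p \in S) (rho^~ opt) p0S.
have js : (index p s < size s)%N by rewrite index_mem sS.
apply: le_trans (best _ js) _.
have [_ [o [_ o_min]]] := appr _ js.
rewrite nth_index ?sS//.
move: (cand _) => x le_x.
(* The guarantee is relative to [o], a fair ranking closest to [p]; since [opt] is fair too, [o] is
   at least as close to [p]. *)
have {o_min}le_px : rho p x <= c * rho p opt.
  by apply: le_trans le_x _; apply: ler_wpM2l => //; move: (o_min _ feas_opt);
    rewrite nth_index ?sS.
apply: Obj_le_scale => //; first by rewrite addr_ge0.
move=> p' p'S; have le_pp' := p_min _ p'S.
apply: le_trans (rhoT p' p x) _.
have le1 := rhoT p' opt p; rewrite (rhoC opt p) in le1.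
apply: le_trans (lerD le1 le_px) _.
(* The two terms of the triangle inequality through [opt] give the factor 2, the approximation error
   gives the factor [c]. *)
rewrite mulrDl [leRHS]addrC; apply: lerD.
  by rewrite mulr_natl mulr2n lerD2l.
exact: ler_wpM2l.
Qed.

End Objective.

(** * Running times *)

Lemma exec_gt0 (R : realType) (q : \bar R) c (fr fr' : frame R) t :
  exec q c fr t fr' -> (0 < t)%N.
Proof. by case. Qed.

(** Total correctness with postcondition [Q]. [T] is only an upper bound on the time, so the rules
    below apply backwards along a program with rounded constants. *)
Definition halts (R : realType) (q : \bar R) (c : cmd) (fr : frame R)
    (T : nat) (Q : frame R -> Prop) : Prop :=
  exists2 t, (t <= T)%N & exists2 fr', exec q c fr t fr' & Q fr'.

Section Halts.
Variables (R : realType) (q : \bar R).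
Implicit Types (fr : frame R) (Q : frame R -> Prop).

Lemma halts_skip fr T Q : (0 < T)%N -> Q fr -> halts q Skip fr T Q.
Proof. by exists 1%N => //; exists fr => //; constructor. Qed.

Lemma halts_setn a i e fr T Q :
  (ncost a + ncost i + ncost e < T)%N ->
  Q (set_int fr (neval fr a) (neval fr i) (neval fr e)) ->
  halts q (SetN a i e) fr T Q.
Proof.
by move=> ? ?; eexists; last by eexists; [exact: exec_setn|].
Qed.

Lemma halts_setr a i e fr T Q :
  (ncost a + ncost i + rcost e < T)%N ->
  Q (set_real fr (neval fr a) (neval fr i) (reval q fr e)) ->
  halts q (SetR a i e) fr T Q.
Proof.
by move=> ? ?; eexists; last by eexists; [exact: exec_setr|].
Qed.

Lemma halts_seq T1 T2 c1 c2 fr T Q :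
  (T1 + T2 < T)%N ->
  halts q c1 fr T1 (fun fr1 => halts q c2 fr1 T2 Q) ->
  halts q (Seq c1 c2) fr T Q.
Proof.
move=> leT [t1 le1 [fr1 ex1 [t2 le2 [fr2 ex2 Q2]]]].
exists (t1 + t2).+1; last by exists fr2 => //; exact: exec_seq ex1 ex2.
by apply: leq_ltn_trans leT; exact: leq_add.
Qed.

Lemma halts_if T1 b c1 c2 fr T Q :
  (bcost b + T1 < T)%N ->
  halts q (if beval q fr b then c1 else c2) fr T1 Q ->
  halts q (If b c1 c2) fr T Q.
Proof.
move=> leT [t1 le1 [fr1 ex1 Q1]].
exists (bcost b + t1).+1; last by exists fr1 => //; exact: exec_if ex1.
by apply: leq_ltn_trans leT; rewrite leq_add2l.
Qed.

Lemma halts_call T1 t out a c args fr T Q :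
  runs q c (eval_args fr args) t out -> (t <= T1)%N ->
  (ncost a + args_cost args + T1 < T)%N ->
  Q (set_arr fr (neval fr a) out) ->
  halts q (Call a c args) fr T Q.
Proof.
move=> [fr' ex ->] le1 leT Q1; eexists; last first.
  by eexists; [exact: exec_call ex|].
by apply: leq_ltn_trans leT; rewrite leq_add2l.
Qed.

(** A loop of exactly [n] rounds, with an invariant indexed by the number of completed rounds. The
    last [bcost b] pays for the final failing test. *)
Lemma halts_for (I : nat -> frame R -> Prop) T1 n b c fr T :
  (forall k fr1, I k fr1 -> beval q fr1 b = (k < n)%N) ->
  (forall k fr1, (k < n)%N -> I k fr1 -> halts q c fr1 T1 (I k.+1)) ->
  I 0%N fr -> (n * (bcost b + T1).+1 + bcost b < T)%N ->
  halts q (While b c) fr T (I n).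
Proof.
move=> Ib Ic I0 leT.
(* Induction on the number [m] of remaining rounds. *)
suff H m : forall k fr1, (k + m)%N = n -> I k fr1 ->
    halts q (While b c) fr1 (m * (bcost b + T1).+1 + bcost b).+1 (I n).
  have [t le_t ex] := H n 0%N fr erefl I0.
  by exists t => //; exact: leq_trans le_t leT.
elim: m => [|m IH] k fr1 kmn Ik.
  rewrite addn0 in kmn; subst k; exists (bcost b).+1 => //; exists fr1 => //.
  by apply: exec_while_stop; rewrite (Ib _ _ Ik) ltnn.
have lt_kn : (k < n)%N by rewrite -kmn -ltn_subLR ?subnn.
have [t1 le1 [fr2 ex2 I2]] := Ic _ _ lt_kn Ik.
have kmn' : (k.+1 + m)%N = n by rewrite addSnnS.
have [t2 le2 [fr3 ex3 I3]] := IH _ _ kmn' I2.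
exists (bcost b + t1 + t2).+1.
  by rewrite mulSn; move: le1 le2; lia.
by exists fr3 => //; apply: exec_while_step ex2 ex3; rewrite (Ib _ _ Ik).
Qed.

End Halts.

(** * The aggregation program *)

(* Local array 1 holds the current candidate, local array 2 the result of the
   last distance computation, and local array 3 the scratch variables. *)
Definition nvar (k : nat) : nexp := NGet Loc (NCst 3) (NCst k).
Definition rvar (k : nat) : rexp := RGet Loc (NCst 3) (NCst k).
Definition outer_index := nvar 0.
Definition inner_index := nvar 1.
Definition best_index := nvar 2.
Definition cur_score := rvar 0.
Definition best_score := rvar 1.
Definition num_rankings := NGet Inp (NCst 1) (NCst 0).
Definition ranking_arr (e : nexp) : Defs.space * nexp := (Inp, NAdd (NCst 2) e).

(** Machine counterpart of [combine], and the only place where the program text depends on [q]. *)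
Definition fold_distance (R : realType) (q : \bar R) : cmd :=
  let x := RGet Loc (NCst 2) (NCst 0) in
  let set := SetR (NCst 3) (NCst 0) in
  if q is _%:E then set (RAdd cur_score (RPowq x))
  else If (BRle cur_score x) (set x) (set cur_score).

Definition score_body (R : realType) (q : \bar R) (D : cmd) : cmd :=
  Seq (Call (NCst 2) D [:: ranking_arr inner_index; (Loc, NCst 1)])
  (Seq (fold_distance q)
       (SetN (NCst 3) (NCst 1) (NAdd inner_index (NCst 1)))).

(* Multiplying both scores by the outer index makes the test succeed in the
   first round, when there is no best candidate yet. *)
Definition keep_best : cmd :=
  If (BRle (RMul (ROfNat outer_index) cur_score)
           (RMul (ROfNat outer_index) best_score))
     (Seq (SetN (NCst 3) (NCst 2) outer_index)
          (SetR (NCst 3) (NCst 1) cur_score))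
     Skip.

Definition candidate_body (R : realType) (q : \bar R) (A D : cmd) : cmd :=
  Seq (Call (NCst 1) A [:: (Inp, NCst 0); ranking_arr outer_index])
  (Seq (SetN (NCst 3) (NCst 1) (NCst 0))
  (Seq (SetR (NCst 3) (NCst 0) (ROfNat (NCst 0)))
  (Seq (While (BNot (BNle num_rankings inner_index)) (score_body q D))
  (Seq keep_best
       (SetN (NCst 3) (NCst 0) (NAdd outer_index (NCst 1))))))).

(* Arrays cannot be copied in constant time, so the best candidate is
   recomputed instead of being saved. *)
Definition aggregate (R : realType) (q : \bar R) (A D : cmd) : cmd :=
  Seq (While (BNot (BNle num_rankings outer_index)) (candidate_body q A D))
      (Call (NCst 0) A [:: (Inp, NCst 0); ranking_arr best_index]).

(** In order: outer, inner and best index, current and best score. *)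
Definition scratch (R : realType) (fr : frame R) : nat * nat * nat * R * R :=
  let x := locals fr 3%N in
  (ints x 0%N, ints x 1%N, ints x 2%N, reals x 0%N, reals x 1%N).

Lemma halts_fold_distance (R : realType) (q : \bar R) (fr : frame R) T Q :
  (20 <= T)%N ->
  Q (set_real fr 3 0
       (combine q (reals (locals fr 3%N) 0%N) (reals (locals fr 2%N) 0%N))) ->
  halts q (fold_distance q) fr T Q.
Proof.
move=> leT QT.
case: q QT => [r||] QT; first by apply: halts_setr => //=; lia.
all: apply: (@halts_if _ _ 10); [by rewrite /=; lia|].
all: move: QT; rewrite /combine /=.
all: by case: leP => ? QT; exact: halts_setr.
Qed.

(** * Loop invariants and running time of the program *)

Section Aggregate.
Variables (R : realType) (q : \bar R) (A D : cmd).
Variables (xP xn : arr R) (xs : seq (arr R)) (n tA tD : nat).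
Variables (out : nat -> arr R) (dist : nat -> nat -> R).
Hypothesis xn_size : ints xn 0%N = n.
Hypothesis runA : forall j, (j < n)%N ->
  exists2 t, (t <= tA)%N & runs q A [:: xP; nth (arr0 R) xs j] t (out j).
Hypothesis runD : forall i j, (i < n)%N -> (j < n)%N ->
  exists2 t, (t <= tD)%N &
  exists2 o, runs q D [:: nth (arr0 R) xs i; out j] t o &
    reals o 0%N = dist j i.

Let inp (i : nat) : arr R := nth (arr0 R) [:: xP, xn & xs] i.
Let partial_score j k := foldl (combine q) 0 (mkseq (dist j) k).
Let score j := partial_score j n.

(** Inner invariant: the distances from candidate [j] to the first [k] inputs have been
    accumulated. *)
Let score_inv j b best k (fr : frame R) :=
  [/\ inputs fr = inp, locals fr 1%N = out j
    & scratch fr = (j, k, b, partial_score j k, best)].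

(** Outer invariant after [j] candidates. The inner index and the current score are left free, since
    each round resets them; the claim on [b] starts at [j = 1], when a best candidate first
    exists. *)
Let best_inv j (fr : frame R) :=
  inputs fr = inp /\
  exists i b acc best, scratch fr = (j, i, b, acc, best) /\
    ((0 < j)%N -> [/\ (b < j)%N, best = score b
                   & forall k, (k < j)%N -> score b <= score k]).

Lemma score_bodyP j b best k fr : (j < n)%N -> (k < n)%N ->
  score_inv j b best k fr ->
  halts q (score_body q D) fr (tD + 60) (score_inv j b best k.+1).
Proof.
move=> jn kn [inpE outE [jE kE bE accE bestE]].
have [t le_t [o run_o oE]] := runD kn jn.
apply: (@halts_seq _ _ (tD + 11) 40); first by lia.
apply: (halts_call (t := t) (out := o) (T1 := tD)) => //.
- by rewrite /= kE inpE outE.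
- by rewrite /args_cost !big_cons big_nil /=; lia.
apply: (@halts_seq _ _ 20 15) => //; apply: halts_fold_distance => //.
apply: halts_setn => //; split=> //.
rewrite /scratch /= /upd /= jE kE bE accE bestE oE addn1.
by rewrite /partial_score mkseqS -cats1 foldl_cat.
Qed.

Lemma candidate_bodyP j fr : (j < n)%N -> best_inv j fr ->
  halts q (candidate_body q A D) fr (tA + n * (tD + 70) + 120)
    (best_inv j.+1).
Proof.
move=> jn [inpE [i [b [acc [best [[jE iE bE accE bestE] b_best]]]]]].
have [t le_t run_t] := runA jn.
apply: (@halts_seq _ _ (tA + 11) (n * (tD + 70) + 100)); first by lia.
apply: (halts_call (t := t) (out := out j) (T1 := tA)) => //.
- by rewrite /= jE inpE.
- by rewrite /args_cost !big_cons big_nil /=; lia.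
apply: (@halts_seq _ _ 4 (n * (tD + 70) + 90)); first by lia.
apply: halts_setn => //.
apply: (@halts_seq _ _ 5 (n * (tD + 70) + 80)); first by lia.
apply: halts_setr => //.
apply: (@halts_seq _ _ (n * (tD + 70) + 10) 60); first by lia.
have loop : forall fr1, score_inv j b best 0 fr1 ->
    halts q (While (BNot (BNle num_rankings inner_index)) (score_body q D)) fr1
      (n * (tD + 70) + 10) (score_inv j b best n).
  move=> fr1 inv0.
  apply: (halts_for (T1 := tD + 60) (I := score_inv j b best)) => //.
  - move=> k fr2 [inp2 _ [_ k2 _ _ _]].
    by rewrite /= inp2 k2 /= xn_size -ltnNge.
  - by move=> k fr2; exact: score_bodyP.
  (* The guard costs 8 and the body at most [tD + 60], so [tD + 70] covers one round. *)
  by rewrite /=; apply: leq_ltn_trans (_ : n * (tD + 70) + 8 < _)%N; nia.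
move: (loop (set_real (set_int (set_arr fr 1 (out j)) 3 1 0) 3 0 0)).
case; first by split=> //; rewrite /scratch /= /upd /= jE bE bestE.
move=> t1 le1 [fr1 ex1 [inp1 _ [j1 k1 b1 acc1 best1]]].
exists t1 => //; exists fr1 => //.
apply: (@halts_seq _ _ 40 15) => //.
apply: (@halts_if _ _ 20) => //=; rewrite j1 acc1 best1.
case: ifP => cmp.
  apply: (@halts_seq _ _ 9 9) => //; apply: halts_setn => //.
  apply: halts_setr => //; apply: halts_setn => //; split=> //.
  exists n, j, (score j), (score j).
  rewrite /scratch /= /upd /= j1 k1 acc1 addn1; split=> // _; split=> // k.
  rewrite ltnS leq_eqVlt => /predU1P[->//|kj].
  (* An earlier candidate [k] forces [j] to be positive, so the factor [j] cancels from the test. *)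
  have j0 : (0 < j)%N by apply: leq_ltn_trans kj.
  have [_ bestS bmin] := b_best j0.
  apply: le_trans (bmin _ kj); rewrite -bestS.
  by move: cmp; rewrite ler_pM2l ?ltr0n.
(* For [j = 0] the test compares 0 with 0 and cannot fail. *)
have j0 : (0 < j)%N by move: cmp; case: (posnP j) => // ->; rewrite !mul0r lexx.
have [bj bestS bmin] := b_best j0.
apply: halts_skip => //; apply: halts_setn => //; split=> //.
exists n, b, (score j), best.
rewrite /scratch /= /upd /= j1 k1 b1 acc1 best1 addn1; split=> // _; split=> //.
  exact: ltnW.
move=> k; rewrite ltnS leq_eqVlt => /predU1P[->|]; last exact: bmin.
move: cmp; rewrite ler_pM2l ?ltr0n// => /negbT; rewrite -ltNge -bestS.
exact: ltW.
Qed.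

Lemma aggregate_runs : (0 < n)%N ->
  exists b, [/\ (b < n)%N, forall j, (j < n)%N -> score b <= score j &
    exists2 t, (t <= n * (tA + n * (tD + 70) + 130) + tA + 30)%N &
      runs q (aggregate q A D) [:: xP, xn & xs] t (out b)].
Proof.
move=> n0.
have : halts q (aggregate q A D) (init_frame [:: xP, xn & xs])
    (n * (tA + n * (tD + 70) + 130) + tA + 30)%N
    (fun fr => exists b, [/\ (b < n)%N,
       forall j, (j < n)%N -> score b <= score j & locals fr 0%N = out b]).
  apply: (@halts_seq _ _ (n * (tA + n * (tD + 70) + 130) + 10) (tA + 15)).
    by lia.
  have [] := @halts_for R q best_inv (tA + n * (tD + 70) + 120) n
    (BNot (BNle num_rankings outer_index)) (candidate_body q A D)
    (init_frame [:: xP, xn & xs])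
    (n * (tA + n * (tD + 70) + 130) + 10)%N.
  - by move=> k fr [inp1 [i [b [acc [best [[k1 _ _ _ _] _]]]]]];
      rewrite /= inp1 k1 /= xn_size -ltnNge.
  - by move=> k fr; exact: candidate_bodyP.
  (* Local arrays start at zero, and the claim on the best index is vacuous before the first
     round. *)
  - by split=> //; exists 0%N, 0%N, 0, 0.
  - by rewrite /=; nia.
  move=> t1 le1 [fr1 ex1 [inp1 [i [b [acc [best [[_ _ b1 _ _] b_best]]]]]]].
  have [bn _ bmin] := b_best n0.
  exists t1 => //; exists fr1 => //.
  have [t le_t run_t] := runA bn.
  apply: (halts_call (t := t) (out := out b) (T1 := tA)) => //.
  - by rewrite /= b1 inp1.
  - by rewrite /args_cost !big_cons big_nil /=; lia.
  by exists b.
move=> [t le_t [fr ex [b [bn bmin outE]]]]; exists b; split=> //.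
by exists t => //; exists fr.
Qed.

End Aggregate.

(** * From the run of the program to the approximation guarantee *)

Theorem theorem4 (R : realType) :
  exists C : nat,
  forall (N : fairness_notion) (K : forall d : nat, fair_params R d -> Prop)
    (rho : forall d : nat, 'S_d -> 'S_d -> R) (q : \bar R) (c : R)
    (t f : nat -> nat) (A D : cmd),
  (forall d : nat, (0 < d)%N -> is_metric (@rho d)) ->
  (1%:E <= q)%E ->
  1 <= c ->
  computes_metric q rho f D ->
  closest_fair_approx q N K rho c t A ->
  exists B : cmd,
    fair_aggregation_approx q N K rho (c + 2)
      (fun n d => (C * (n * t d + n ^ 2 * f d))%N) B.
Proof.
exists 200%N => N K rho q c t f A D metric q1 c1 runsD runsA.
exists (aggregate q A D) => d P S s xP xn xs KP feas S0 us sS reprP xnE xs_size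
  repr_s.
(* The metric axioms and the correctness of [D] are assumed for positive [d] only. *)
have d0 : (0 < d)%N by case/andP: (kpar_range P) => k0; exact: leq_trans.
have sizeS : #|S| = size s by rewrite -(eq_card sS); apply/card_uniqP.
have n0 : (0 < size s)%N by rewrite -sizeS card_gt0.
pose is_cand j (v : arr R * 'S_d) :=
  [/\ exists2 tau, (tau <= t d)%N &
        runs q A [:: xP; nth (arr0 R) xs j] tau v.1,
      repr_ranking v.2 v.1
    & is_approx (fair N P) (rho d (nth 1%g s j)) c v.2].
(* One output array and the ranking it encodes are fixed for each input, so that the final
   recomputation yields the very candidate that was scored. Out of range the value is arbitrary. *)
have /choice[cand candP] : forall j, exists v,
    (j < size s)%N -> is_cand j v.
  move=> j.
  have [js|js] := ltnP j (size s); last by exists (arr0 R, 1%g).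
  have [tau le_tau [o run_o [sg repr_o appr]]] :=
    runsA d P _ _ _ KP feas reprP (repr_s j js).
  by exists (o, sg) => _; split=> //; exists tau.
pose out j := (cand j).1; pose dist j i := rho d (nth 1%g s i) (cand j).2.
have runA j : (j < size s)%N -> exists2 tau, (tau <= t d)%N &
    runs q A [:: xP; nth (arr0 R) xs j] tau (out j).
  by move=> /candP[].
have runD i j : (i < size s)%N -> (j < size s)%N ->
    exists2 tau, (tau <= f d)%N &
    exists2 o, runs q D [:: nth (arr0 R) xs i; out j] tau o &
      reals o 0%N = dist j i.
  by move=> /repr_s repr_i /candP[_ repr_j _]; exact: runsD.
(* Every execution takes positive time, so [t d] and [f d] are at least 1 and absorb the additive
   constants: the total is at most [162 * n * t d + 71 * n ^ 2 * f d], within the constant 200. *)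
have t0 : (0 < t d)%N.
  have [tau le_tau [fr ex _]] := runA _ n0.
  exact: leq_trans (exec_gt0 ex) le_tau.
have f0 : (0 < f d)%N.
  have [tau le_tau [o [fr ex _] _]] := runD _ _ n0 n0.
  exact: leq_trans (exec_gt0 ex) le_tau.
rewrite sizeS in xnE *.
have [b [bs bmin [tau le_tau run_b]]] := aggregate_runs xnE runA runD n0.
exists tau; first by apply: leq_trans le_tau _; rewrite expnS expn1; nia.
exists (out b) => //; exists (cand b).2; first by have [] := candP _ bs.
apply: (best_candidate_approx q1 (s := s) (cand := fun j => (cand j).2)) => //.
- exact: metric.
- exact: le_trans c1.
- by move=> j /candP[].
move=> j /bmin le_bj; apply: (le_Obj_combine q1 us sS).
(* Identifies the program's score, indexed by positions, with the fold over the enumeration [s]. *)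
have mapE k : [seq rho d p (cand k).2 | p <- s] = mkseq (dist k) (size s).
  apply: (@eq_from_nth _ 0); rewrite ?size_mkseq size_map// => i si.
  by rewrite (nth_map 1%g)// nth_mkseq.
by rewrite !mapE.
Qed.
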